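(* Let $\kappa>0$, let $W$ be a real skew-symmetric $(d+1)\times(d+1)$ matrix, and let $V=aI_{d+1}+W$ with $$\|W\|<a\ll1.$$ Let the natural frequency matrices be identical, $\Omega_i\equiv\Omega$ for all $i=1,\dots,N$, with $\Omega$ real skew-symmetric of size $(d+1)\times(d+1)$. Let $x_1(t),\dots,x_N(t)\in\mathbb S^d$, $t\ge0$, be a solution of the Lohe sphere model with frustration $$\dot x_i=\Omega x_i+\frac{\kappa}{N}\sum_{k=1}^N\big(Vx_k-\langle x_i,Vx_k\rangle x_i\big),\qquad x_i(0)=x_i^0\in\mathbb S^d,\qquad i=1,\dots,N,$$ whose initial data satisfy $$\max_{1\le i,j\le N}\big(1-\langle x_i^0,x_j^0\rangle\big)<1-\frac{\|W\|}{a}.$$ Then complete aggregation occurs: $$\lim_{t\to\infty}\max_{1\le i,j\le N}\|x_i(t)-x_j(t)\|=0.$$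
   Context: $\mathbb S^d$ is the unit sphere in $\mathbb R^{d+1}$ with Euclidean inner product $\langle\cdot,\cdot\rangle$ and norm $\|\cdot\|$; $\|W\|$ is the operator norm of $W$. The condition $a\ll1$ means that the positive constant $a$ is assumed to be small; no explicit threshold is specified. *)

(* Defs.v *)
From HB Require Import structures.
From mathcomp Require Export all_boot all_order all_algebra.
From mathcomp Require Export all_classical all_reals all_analysis.
Export Order.TTheory GRing.Theory Num.Theory.
Export numFieldNormedType.Exports.

Set Implicit Arguments.
Unset Strict Implicit.
Unset Printing Implicit Defensive.

#[global] Open Scope classical_set_scope.
#[global] Open Scope ring_scope.

Definition dotv (R : realType) (n : nat) (u v : 'cV[R]_n) : R :=
  \sum_(i < n) u i 0 * v i 0.

(* The library norm `|u| of a matrix is the sup norm, hence a separate Euclidean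
   norm; both induce the same topology, so limits and derivatives of
   vector-valued functions below are the usual ones. *)
Definition enorm (R : realType) (n : nat) (u : 'cV[R]_n) : R :=
  Num.sqrt (dotv u u).

Definition opnorm (R : realType) (m n : nat) (A : 'M[R]_(m, n)) : R :=
  sup [set enorm (A *m u) | u in [set u : 'cV[R]_n | enorm u <= 1]].

Definition unit_sphere (R : realType) (d : nat) : set 'cV[R]_d.+1 :=
  [set u | enorm u = 1].

Definition skew_mx (R : realType) (n : nat) (A : 'M[R]_n) : Prop :=
  A^T = - A.

(* The default value 0 plays no role when N > 0 and F is nonnegative; it is only
   used for such F: distances, and 1 - <x_i, x_j> for unit vectors. *)
Definition max_pairs (R : realType) (N : nat) (F : 'I_N -> 'I_N -> R) : R :=
  \big[Num.max/0]_(i < N) \big[Num.max/0]_(j < N) F i j.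

Definition lohe_field (R : realType) (d N : nat) (kappa : R)
    (V : 'M[R]_d.+1) (Omega : 'I_N -> 'M[R]_d.+1)
    (y : 'I_N -> 'cV[R]_d.+1) (i : 'I_N) : 'cV[R]_d.+1 :=
  Omega i *m y i +
  (kappa / N%:R) *:
    \sum_(k < N) (V *m y k - dotv (y i) (V *m y k) *: y i).

(* Functions of time are total, but only their values at t >= 0 are
   constrained: at t = 0 the derivative is the right derivative. *)
Record lohe_solution (R : realType) (d N : nat) (kappa : R)
    (V : 'M[R]_d.+1) (Omega : 'I_N -> 'M[R]_d.+1)
    (x0 : 'I_N -> 'cV[R]_d.+1) (x : 'I_N -> R -> 'cV[R]_d.+1) : Prop :=
  LoheSolution {
    lohe_init : forall i : 'I_N, x i 0 = x0 i;
    lohe_sphere : forall (i : 'I_N) (t : R), 0 <= t -> unit_sphere (x i t);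
    lohe_deriv0 : forall i : 'I_N,
      h^-1 *: (x i h - x i 0) @[h --> (0 : R)^'+] -->
        lohe_field kappa V Omega (fun k => x k 0) i;
    lohe_deriv : forall (i : 'I_N) (t : R), 0 < t ->
      is_derive t 1 (x i) (lohe_field kappa V Omega (fun k => x k t) i)
  }.

(* Main.v *)
Require Import Defs.
From mathcomp Require Import ring lra.

(* Put h_ij = <x_i, x_j>. The free flow is a common rotation and drops out of
   h_ij, which leaves
     (1 - h_ij)' = - (kappa / N) (1 - h_ij) sum_k (<x_i, V x_k> + <x_j, V x_k>).
   Since <x_i, V x_k> >= a h_ik - |W|, the sum is positive as long as all the
   1 - h_ij are below 1 - |W| / a. All 1 - h_ij then decrease, so this region is
   never left; inside it they decay exponentially, and
   |x_i - x_j|^2 = 2 (1 - h_ij). *)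

Set Implicit Arguments.
Unset Strict Implicit.
Unset Printing Implicit Defensive.

(** * Euclidean geometry of column vectors and the operator norm *)

Section InnerProduct.
Context {R : realType} {n : nat}.
Implicit Types (u v w : 'cV[R]_n) (A : 'M[R]_n).

Lemma dotvE u v : dotv u v = (u^T *m v) 0 0.
Proof. by rewrite mxE; apply: eq_bigr => i _; rewrite mxE. Qed.

Lemma dotvC u v : dotv u v = dotv v u.
Proof. by apply: eq_bigr => i _; rewrite mulrC. Qed.

Lemma dotvDl u v w : dotv (u + v) w = dotv u w + dotv v w.
Proof. by rewrite !dotvE linearD mulmxDl mxE. Qed.

Lemma dotvZl c u v : dotv (c *: u) v = c * dotv u v.
Proof. by rewrite !dotvE linearZ -scalemxAl mxE. Qed.

Lemma dotvBl u v w : dotv (u - v) w = dotv u w - dotv v w.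
Proof. by rewrite dotvDl -scaleN1r dotvZl mulN1r. Qed.

Lemma dotvDr u v w : dotv u (v + w) = dotv u v + dotv u w.
Proof. by rewrite dotvC dotvDl !(dotvC u). Qed.

Lemma dotvZr c u v : dotv u (c *: v) = c * dotv u v.
Proof. by rewrite dotvC dotvZl dotvC. Qed.

Lemma dotvBr u v w : dotv u (v - w) = dotv u v - dotv u w.
Proof. by rewrite dotvC dotvBl !(dotvC u). Qed.

Lemma dotv_suml (I : finType) (F : I -> 'cV[R]_n) v :
  dotv (\sum_i F i) v = \sum_i dotv (F i) v.
Proof.
rewrite dotvE linear_sum mulmx_suml summxE.
by apply: eq_bigr => i _; rewrite dotvE.
Qed.

Lemma dotv_ge0 u : 0 <= dotv u u.
Proof. by apply: sumr_ge0 => i _; rewrite -expr2 sqr_ge0. Qed.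

Lemma dotv_skew A u v : skew_mx A -> dotv (A *m u) v = - dotv u (A *m v).
Proof. by move=> skA; rewrite !dotvE trmx_mul skA mulmxA mulmxN mulNmx mxE. Qed.

Lemma sqr_enorm u : enorm u ^+ 2 = dotv u u.
Proof. by rewrite sqr_sqrtr ?dotv_ge0. Qed.

Lemma enorm_ge0 u : 0 <= enorm u.
Proof. exact: sqrtr_ge0. Qed.

Lemma dotv_unit u : enorm u = 1 -> dotv u u = 1.
Proof. by rewrite -sqr_enorm => ->; rewrite expr1n. Qed.

Lemma Cauchy_Schwarz_dotv u v : dotv u v ^+ 2 <= dotv u u * dotv v v.
Proof.
have [v0|v_neq0] := eqVneq (dotv v v) 0.
  have vi0 i : v i 0 = 0.
    have := v0; move/eqP; rewrite psumr_eq0; last first.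
      by move=> j _; rewrite -expr2 sqr_ge0.
    by move=> /allP/(_ i (mem_index_enum _)); rewrite mulf_eq0 orbb => /eqP.
  rewrite v0 mulr0 [dotv u v]big1 ?expr0n// => i _.
  by rewrite vi0 mulr0.
have v_gt0 : 0 < dotv v v by rewrite lt_def v_neq0 dotv_ge0.
(* This vector is [dotv v v] times the component of [u] orthogonal to [v]; expanding its square
   gives the inequality multiplied by [dotv v v]. *)
have := dotv_ge0 (dotv v v *: u - dotv u v *: v).
rewrite !(dotvBl, dotvBr, dotvZl, dotvZr) (dotvC v u).
rewrite (_ : _ - _ = dotv v v * (dotv u u * dotv v v - dotv u v ^+ 2)).
  by rewrite pmulr_rge0// subr_ge0.
by ring.
Qed.

Lemma normr_dotv_le u v : `|dotv u v| <= enorm u * enorm v.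
Proof.
rewrite -ler_sqr ?nnegrE ?mulr_ge0 ?enorm_ge0//.
by rewrite real_normK ?num_real// exprMn !sqr_enorm Cauchy_Schwarz_dotv.
Qed.

(** Cauchy-Schwarz on each row gives the Frobenius norm as [C]. This bounds the set whose supremum
    is [opnorm A], so that the supremum is a genuine upper bound. *)
Lemma enorm_mulmx_le A :
  exists2 C, 0 <= C & forall u, enorm (A *m u) <= C * enorm u.
Proof.
pose S := \sum_i dotv (row i A)^T (row i A)^T.
exists (Num.sqrt S) => [|u]; first exact: sqrtr_ge0.
rewrite -sqrtrM; last by apply: sumr_ge0 => i _; exact: dotv_ge0.
apply: ler_wsqrtr; rewrite mulr_suml; apply: ler_sum => i _.
rewrite -expr2 (_ : (A *m u) i 0 = dotv (row i A)^T u).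
  exact: Cauchy_Schwarz_dotv.
by rewrite dotvE trmxK -row_mul [RHS]mxE.
Qed.

Lemma enorm_le_opnorm A u : enorm u <= 1 -> enorm (A *m u) <= opnorm A.
Proof.
move=> u1; apply: ub_le_sup; last by exists u.
have [C C0 AC] := enorm_mulmx_le A.
exists C => _ [v v1 <-]; apply: le_trans (AC v) _.
by rewrite -[leRHS]mulr1 ler_wpM2l.
Qed.

Lemma dotv_mulmx_ge A u v :
  enorm u = 1 -> enorm v = 1 -> - opnorm A <= dotv u (A *m v).
Proof.
move=> u1 v1; rewrite lerNl; apply: le_trans (ler_norm _) _.
rewrite normrN; apply: le_trans (normr_dotv_le _ _) _.
by rewrite u1 mul1r enorm_le_opnorm// v1.
Qed.

Lemma enormB_unit u v :
  enorm u = 1 -> enorm v = 1 -> enorm (u - v) = Num.sqrt (2 * (1 - dotv u v)).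
Proof.
move=> u1 v1; rewrite /enorm !(dotvBl, dotvBr) !dotv_unit// (dotvC v u).
by congr Num.sqrt; ring.
Qed.

End InnerProduct.

(** * Differential inequalities on the half-line, with only a right limit at 0 *)

Section Calculus.
Context {R : realType}.

Lemma is_derive_dotv n (u v : R -> 'cV[R]_n) (t : R) (du dv : 'cV[R]_n) :
  is_derive t 1 u du -> is_derive t 1 v dv ->
  is_derive t 1 (fun s => dotv (u s) (v s)) (dotv du (v t) + dotv (u t) dv).
Proof.
move=> dfu dfv.
have coord (w : R -> 'cV[R]_n) dw i : is_derive t 1 w dw ->
    is_derive t 1 (fun s => w s i 0) (dw i 0).
  move=> [wt <-]; rewrite derive_mx// mxE; apply/derivableP.
  by move/derivable_mxP : wt => /(_ i 0).
have -> : (fun s => dotv (u s) (v s)) =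
    \sum_(i < n) ((fun s => u s i 0) * (fun s => v s i 0)).
  by apply/funext => s; rewrite fct_sumE.
rewrite -big_split/=; apply: is_derive_sum => i.
have dM := is_deriveM (coord _ _ i dfu) (coord _ _ i dfv).
apply: (is_derive_eq dM).
by rewrite /GRing.scale/= addrC (mulrC (v t i 0)).
Qed.

Lemma cvg_dotv n (T : Type) (F : set_system T) (FF : Filter F)
    (u v : T -> 'cV[R]_n) (a b : 'cV[R]_n) :
  u s @[s --> F] --> a -> v s @[s --> F] --> b ->
  dotv (u s) (v s) @[s --> F] --> dotv a b.
Proof.
move=> ua vb; apply: cvg_big => [|i _]; first exact: add_continuous.
apply: cvgM.
  by apply: (cvg_comp u (fun M : 'cV[R]_n => M i 0)); [exact: ua|exact: coord_continuous].
by apply: (cvg_comp v (fun M : 'cV[R]_n => M i 0)); [exact: vb|exact: coord_continuous].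
Qed.

(** For [h] nonzero, [f h] is [f 0] plus [h] times the difference quotient, and the latter product
    tends to [0 *: l]. *)
Lemma right_derivable_continuous (V : normedModType R) (f : R -> V) (l : V) :
  h^-1 *: (f h - f 0) @[h --> (0 : R)^'+] --> l -> f h @[h --> (0 : R)^'+] --> f 0.
Proof.
move=> fl.
have id0 : h @[h --> (0 : R)^'+] --> (0 : R) by exact: cvg_at_right_filter.
have f0 : f 0 + h *: (h^-1 *: (f h - f 0)) @[h --> (0 : R)^'+] --> f 0.
  rewrite -[X in _ --> X]addr0 -(scale0r l).
  by apply: cvgD; [exact: cvg_cst|exact: cvgZ].
apply: cvg_trans f0; apply: near_eq_cvg.
near=> h; have h0 : h != 0 by rewrite gt_eqF.
by rewrite /= scalerA divff// scale1r addrC subrK.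
Unshelve. all: by end_near. Qed.

Lemma within_continuous_right (f : R -> R) (b : R) : 0 < b ->
  f h @[h --> (0 : R)^'+] --> f 0 ->
  (forall t : R, 0 < t -> derivable f t 1) -> {within `[0, b], continuous f}.
Proof.
move=> b0 f0 df.
have cf t : 0 < t -> {for t, continuous f}.
  by move=> t0; apply: differentiable_continuous; apply/derivable1_diffP/df.
apply/continuous_within_itvP => //; split => //.
- by move=> t; rewrite in_itv/= => /andP[t0 _]; exact: cf.
- exact/cvg_at_left_filter/cf.
Qed.

(** Solutions are unconstrained at negative times, so no two-sided derivative or continuity at 0 can
    be asked for; right continuity there suffices for the mean value argument. *)
Lemma nonincreasing_from0 (f : R -> R) (b : R) : 0 <= b ->
  f h @[h --> (0 : R)^'+] --> f 0 ->
  (forall t : R, 0 < t -> derivable f t 1) ->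
  (forall t : R, 0 < t < b -> derive1 f t <= 0) -> f b <= f 0.
Proof.
rewrite le_eqVlt => /predU1P[<-//|b0] f0 df f'.
apply: (@ler0_derive1_le_cc _ f 0 b).
- by move=> t; rewrite in_itv/= => /andP[t0 _]; exact: df.
- by move=> t; rewrite in_itv/=; exact: f'.
- exact: within_continuous_right.
- by rewrite in_itv/= lexx ltW.
- by rewrite in_itv/= lexx ltW.
- exact: ltW.
Qed.

(* First-exit argument: on the interval before the infimum of the times at which
   some [g i] reaches [D1], all the [g i] decrease, so they are still at most
   [D0] at that infimum. *)
Lemma sublevel_invariant (I : finType) (g : I -> R -> R) (D0 D1 : R) :
  D0 < D1 ->
  (forall i, g i h @[h --> (0 : R)^'+] --> g i 0) ->
  (forall i (t : R), 0 < t -> derivable (g i) t 1) ->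
  (forall i (t : R), 0 < t -> (forall j, g j t < D1) -> derive1 (g i) t <= 0) ->
  (forall i, g i 0 <= D0) ->
  forall i t, 0 <= t -> g i t < D1.
Proof.
move=> D01 g0 dg g' gD0.
pose S := [set t : R | 0 <= t /\ exists i, D1 <= g i t].
suff S0 : S = set0.
  move=> i t t0; rewrite ltNge; apply/negP => gt.
  by have : S t by [split => //; exists i]; rewrite S0.
apply/eqP/negPn/negP => /set0P Sne.
have Slb : lbound S 0 by move=> t [].
have hS : has_inf S by split => //; exists 0.
pose s := inf S.
have s0 : 0 <= s by exact: lb_le_inf.
have below t : 0 <= t -> t < s -> forall j, g j t < D1.
  move=> t0 ts j; rewrite ltNge; apply/negP => gt.
  have : s <= t by apply: ge_inf; [exists 0|split => //; exists j].
  by rewrite leNgt ts.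
have gs i : g i s < D1.
  apply: le_lt_trans D01; apply: le_trans (gD0 i).
  apply: nonincreasing_from0 => // t; first exact: dg.
  move=> /andP[t0 ts].
  by apply: g' => // j; apply: below => //; exact: ltW.
have gr i : g i h @[h --> s^'+] --> g i s.
  (* If the infimum is 0, right continuity is the hypothesis [g0]; otherwise it follows from
     differentiability. *)
  move: s0; rewrite le_eqVlt => /predU1P[<-//|s0].
  apply/cvg_at_right_filter/differentiable_continuous.
  exact/derivable1_diffP/dg.
(* Since [I] is finite, one right neighbourhood of [s] serves all indices. But [S] has points
   arbitrarily close to its infimum, and such a point can lie neither before [s], nor at [s], nor in
   this neighbourhood. *)
have : \forall t \near s^'+, forall i, g i t < D1.
  by apply: filter_forall => i; exact: cvgr_lt (gr i) _ (gs i).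
rewrite /at_right near_withinE => -[e /= e0 He].
have [t [t0 [i D1t]] ts] := inf_adherent e0 hS.
have [ts'|st] := ltP t s; first by have := below _ t0 ts' i; rewrite ltNge D1t.
move: st; rewrite le_eqVlt => /predU1P[st|st].
  by have := gs i; rewrite st ltNge D1t.
have : g i t < D1.
  apply: (He t) => //=; rewrite -/s in ts.
  by rewrite ltr_norml; apply/andP; split; lra.
by rewrite ltNge D1t.
Qed.

(** Gronwall: the derivative of [f t * expR (c * t)] is [expR (c * t)] times
    [derive1 f t + c * f t], hence nonpositive. *)
Lemma exp_decay (f : R -> R) (c : R) :
  f h @[h --> (0 : R)^'+] --> f 0 ->
  (forall t : R, 0 < t -> derivable f t 1) ->
  (forall t : R, 0 < t -> derive1 f t <= - c * f t) ->
  forall t, 0 <= t -> f t <= f 0 * expR (- c * t).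
Proof.
move=> f0 df f' t t0.
pose e s : R := expR (c * s).
have de (s : R) : is_derive s 1 e (c * e s).
  have dcs := is_deriveZ c (is_derive_id s 1).
  apply: (is_derive_eq (is_derive1_comp (is_derive_expR _) dcs)).
  by rewrite /GRing.scale/= mulr1 mulrC.
have dfe (s : R) : 0 < s -> is_derive s 1 (f * e) (f s *: (c * e s) + e s *: derive1 f s).
  move=> s0; apply: is_deriveM => //.
  by rewrite derive1E; apply/derivableP/df.
have fe : (f * e) t <= (f * e) 0.
  apply: nonincreasing_from0 => //.
  - apply: cvgM => //; apply/cvg_at_right_filter/differentiable_continuous.
    by apply/derivable1_diffP; have [] := de 0.
  - by move=> s s0; have [] := dfe s s0.
  - move=> s /andP[s0 _]; rewrite derive1E; have [_ ->] := dfe s s0.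
    rewrite /GRing.scale/= mulrCA -subr_ge0.
    have : 0 <= e s * (- c * f s - derive1 f s) by rewrite mulr_ge0 ?expR_ge0// subr_ge0 f'.
    by nra.
have {fe} : f t * e t <= f 0 * e 0 := fe.
by rewrite /e mulr0 expR0 mulr1 mulNr expRN ler_pdivlMr ?expR_gt0.
Qed.

End Calculus.

(** * Inner products along the flow and the effect of frustration *)

Section LoheFlow.
Context {R : realType} {d N : nat}.
Variables (kappa : R) (V Omega : 'M[R]_d.+1).

(** By the product rule the left side is the derivative of the inner product of two particles; the
    two [Omega] terms are opposite by skewness. *)
Lemma dotv_lohe_field (y : 'I_N -> 'cV[R]_d.+1) (i j : 'I_N) :
  skew_mx Omega ->
  dotv (lohe_field kappa V (fun=> Omega) y i) (y j) +
  dotv (y i) (lohe_field kappa V (fun=> Omega) y j) =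
  kappa / N%:R * \sum_k
    ((dotv (y j) (V *m y k) - dotv (y i) (y j) * dotv (y i) (V *m y k)) +
     (dotv (y i) (V *m y k) - dotv (y i) (y j) * dotv (y j) (V *m y k))).
Proof.
move=> skO; rewrite /lohe_field dotvDl dotvDr (dotv_skew _ _ skO).
rewrite addrACA addNr add0r dotvZl dotvZr -mulrDr; congr (_ * _).
rewrite [in X in _ + X]dotvC !dotv_suml -big_split/=; apply: eq_bigr => k _.
rewrite !dotvBl !dotvZl (dotvC (V *m y k)) (dotvC (V *m y k)) (dotvC (y j) (y i)).
by ring.
Qed.

End LoheFlow.

(** The scalar part of the coupling contributes [a * dotv u v], and the part [W] takes away at most
    [opnorm W] on unit vectors. *)
Lemma dotv_frustration_ge (R : realType) (d : nat) (a D : R) (W : 'M[R]_d.+1)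
    (u v : 'cV[R]_d.+1) :
  0 < a -> enorm u = 1 -> enorm v = 1 -> 1 - dotv u v <= D ->
  a * (1 - D) - opnorm W <= dotv u ((a%:M + W) *m v).
Proof.
move=> a0 u1 v1 uvD; rewrite mulmxDl mul_scalar_mx dotvDr dotvZr.
by apply: lerD; [rewrite ler_pM2l//; lra|exact: dotv_mulmx_ge].
Qed.

(** A squeeze: the default 0 in [max_pairs] supplies the lower bound, and is also why [h] must be
    nonnegative. *)
Lemma max_pairs_cvg0 (R : realType) (N : nat) (T : Type) (F : set_system T)
    (FF : Filter F) (f : T -> 'I_N -> 'I_N -> R) (h : T -> R) :
  (\forall t \near F, 0 <= h t /\ forall i j, f t i j <= h t) ->
  h t @[t --> F] --> (0 : R) -> max_pairs (f t) @[t --> F] --> (0 : R).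
Proof.
move=> fh; apply: squeeze_cvgr (cvg_cst 0).
apply: filterS fh => t [h0 fh]; apply/andP; split; first exact: bigmax_ge_id.
by apply: bigmax_le => // i _; exact: bigmax_le.
Qed.

(** * Decay of all pairwise defects and complete aggregation *)

Theorem theorem4p2 (R : realType) :
  exists2 a0 : R, 0 < a0 &
    forall (d N : nat) (kappa a : R) (W Omega : 'M[R]_d.+1)
      (x0 : 'I_N -> 'cV[R]_d.+1) (x : 'I_N -> R -> 'cV[R]_d.+1),
    (0 < N)%N ->
    0 < kappa ->
    skew_mx W ->
    skew_mx Omega ->
    0 < a ->
    opnorm W < a ->
    a < a0 ->
    (forall i : 'I_N, unit_sphere (x0 i)) ->
    lohe_solution kappa (a%:M + W) (fun=> Omega) x0 x ->
    max_pairs (fun i j => 1 - dotv (x0 i) (x0 j)) < 1 - opnorm W / a ->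
    max_pairs (fun i j => enorm (x i t - x j t)) @[t --> +oo] --> (0 : R).
Proof.
exists 1 => // d N kappa a W Omega x0 x N0 k0 _ skO a0 _ _ _ sol.
set D0 := max_pairs _ => D0lt.
(* The midpoint leaves room on both sides: [D0 < D1] feeds the first-exit argument, and [D1] below
   the threshold makes [delta], the lower bound for each [dotv (x i t) (V *m x k t)], positive. *)
pose D1 := (D0 + (1 - opnorm W / a)) / 2.
pose delta := a * (1 - D1) - opnorm W.
have delta0 : 0 < delta.
  have -> : delta = a * (1 - opnorm W / a - D0) / 2.
    by rewrite /delta /D1; field; rewrite gt_eqF.
  by rewrite divr_gt0// mulr_gt0// subr_gt0.
have D01 : D0 < D1 by rewrite /D1; lra.
pose V := a%:M + W.
have sph i (t : R) : 0 <= t -> enorm (x i t) = 1.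
  by move=> t0; exact: (lohe_sphere sol).
(* Pairs form a single finite index type, as [sublevel_invariant] expects. *)
pose g (p : 'I_N * 'I_N) (t : R) := 1 - dotv (x p.1 t) (x p.2 t).
pose S (p : 'I_N * 'I_N) (t : R) :=
  \sum_k (dotv (x p.1 t) (V *m x k t) + dotv (x p.2 t) (V *m x k t)).
have g_ge0 p (t : R) : 0 <= t -> 0 <= g p t.
  move=> t0; rewrite subr_ge0; apply: le_trans (ler_norm _) _.
  by apply: le_trans (normr_dotv_le _ _) _; rewrite !sph// mulr1.
have x_right i : x i h @[h --> (0 : R)^'+] --> x i 0.
  exact: right_derivable_continuous (@lohe_deriv0 _ _ _ _ _ _ _ _ sol i).
have g_right p : g p h @[h --> (0 : R)^'+] --> g p 0.
  by apply: cvgB; [exact: cvg_cst|exact: cvg_dotv].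
have dg p (t : R) : 0 < t ->
    is_derive t 1 (g p) (- (kappa / N%:R * S p t * g p t)).
  move=> t0.
  have dx i := lohe_deriv sol i t0.
  have := is_deriveB (is_derive_cst (1 : R) t 1) (is_derive_dotv (dx p.1) (dx p.2)).
  move=> dB; apply: (is_derive_eq dB).
  rewrite (dotv_lohe_field kappa V (fun k => x k t))// sub0r -!mulrA.
  (* Regrouping each summand makes the factor [g p t] appear. *)
  congr (- (_ * (_ * _))); rewrite mulr_suml; apply: eq_bigr => k _.
  by rewrite /g; ring.
have g_derivable p (t : R) : 0 < t -> derivable (g p) t 1.
  by move=> t0; have [] := dg p t t0.
have g_derive p (t : R) : 0 < t ->
    derive1 (g p) t = - (kappa / N%:R * S p t * g p t).
  by move=> t0; rewrite derive1E; have [_] := dg p t t0.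
have rate p (t : R) : 0 < t -> (forall q, g q t < D1) ->
    2 * kappa * delta <= kappa / N%:R * S p t.
  move=> t0 gD1; have N0' : 0 < N%:R :> R by rewrite ltr0n.
  (* The sum [S p t] has [N] terms, each made of two products at least [delta]; the factor [N]
     cancels. *)
  rewrite (_ : 2 * _ * _ = kappa / N%:R * \sum_(k < N) (delta + delta)); last first.
    by rewrite sumr_const card_ord -mulr_natl; field; rewrite gt_eqF.
  rewrite ler_pM2l ?divr_gt0//; apply: ler_sum => k _.
  have bound i : delta <= dotv (x i t) (V *m x k t).
    apply: dotv_frustration_ge; rewrite ?sph ?ltW//.
    exact: (gD1 (i, k)).
  exact: lerD.
have g0 p : g p 0 <= D0.
  rewrite /g !(lohe_init sol).
  apply: le_trans (le_bigmax _ _ p.1).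
  exact: (le_bigmax _ (fun j => 1 - dotv (x0 p.1) (x0 j))).
have gD1 : forall p (t : R), 0 <= t -> g p t < D1.
  apply: (sublevel_invariant D01) => // p t t0 gD1.
  rewrite g_derive// oppr_le0 mulr_ge0 ?g_ge0 ?ltW//.
  by apply: lt_le_trans (rate p t t0 gD1); rewrite !mulr_gt0.
pose c := 2 * kappa * delta.
have decay p (t : R) : 0 <= t -> g p t <= g p 0 * expR (- c * t).
  move=> t0; apply: exp_decay => // s s0; first exact: g_derivable.
  rewrite g_derive// mulNr lerN2.
  apply: ler_wpM2r; first by rewrite g_ge0// ltW.
  by apply: rate => // q; rewrite gD1// ltW.
(* The squared distance of two unit vectors is twice their defect [g]; replacing [g p 0] by [D0]
   makes the bound uniform over pairs. *)
apply: (@max_pairs_cvg0 _ _ _ _ _ _ (fun t => Num.sqrt (2 * D0 * expR (- c * t)))).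
  near=> t; have t0 : 0 <= t by near: t; exact: nbhs_pinfty_ge.
  split=> [|i j]; first exact: sqrtr_ge0.
  rewrite enormB_unit ?sph//; apply: ler_wsqrtr; rewrite -mulrA ler_pM2l//.
  apply: le_trans (decay (i, j) t t0) _.
  by rewrite ler_wpM2r ?expR_ge0.
rewrite -(sqrtr0 R) -(mulr0 (2 * D0)).
apply: (cvg_comp _ Num.sqrt); last exact: sqrt_continuous.
apply: cvgMr.
have -> : (fun t : R => expR (- c * t)) = (fun t => expR (- t)) \o *%R c.
  by apply/funext => t /=; rewrite mulNr.
apply: (cvg_comp _ (fun t : R => expR (- t)) _ (@cvgr_expR R)).
by apply: gt0_cvgMry; [rewrite !mulr_gt0|exact: cvg_id].
Unshelve. all: by end_near. Qed.
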